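(* Let $(C_\alpha)_{\alpha\in A}$ be a net of random closed sets in $E$, $C_\alpha$ being defined on a probability space $(\Omega_\alpha,\mathcal{A}_\alpha,\mathbb{P}_\alpha)$, and let $C$ be a random closed set in $E$ on a probability space $(\Omega,\mathcal{A},\mathbb{P})$. For each $\alpha \in A$ let $\xi_\alpha:(\Omega_\alpha,\mathcal{A}_\alpha) \rightarrow (E,\mathcal{B}(E))$ be a measurable map (random variable in $E$). Suppose that: (i) $C_\alpha \stackrel{\mathcal{D}}{\rightarrow} C$ in $(\mathcal{F},\tau_{uF})$. (ii) $\limsup_\alpha \mathbb{P}_\alpha(\xi_\alpha \notin C_\alpha)=0$. (iii) For every $\epsilon>0$ there exists a $K \in \mathcal{K}$ such that $\liminf_\alpha \mathbb{P}_\alpha(\xi_\alpha \in K) \ge 1-\epsilon.$ Then $$\limsup_\alpha \mathbb{P}_\alpha(\xi_\alpha \in F) \le T_C(F) \quad \text{for all } F \in \mathcal{F},$$ where $T_C$ is the (Choquet) capacity functional of $C$, given by $T_C(B)=\mathbb{P}(C \cap B \neq \emptyset)$. If in addition $C \subseteq \{\xi\}$ $\mathbb{P}$-a.s. for some random variable $\xi$ in $E$ on $(\Omega,\mathcal{A},\mathbb{P})$, then $$\xi_\alpha \stackrel{\mathcal{D}}{\rightarrow} \xi \quad \text{ in } (E,\mathcal{G}).$$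
   Context: $(E,\mathcal{G})$ is a non-empty locally compact, second-countable Hausdorff space with Borel $\sigma$-algebra $\mathcal{B}(E)$; $\mathcal{G}$ is the family of its open sets, and $\mathcal{F}$ and $\mathcal{K}$ are the families of all closed and all compact subsets of $E$. For $A\subseteq E$ put $\mathcal{M}(A)=\{F\in\mathcal{F}: F\cap A=\emptyset\}$ and $\mathcal{H}(A)=\{F\in\mathcal{F}: F\cap A\neq\emptyset\}$. The Fell topology $\tau_F$ on $\mathcal{F}$ is generated by $\{\mathcal{M}(K):K\in\mathcal{K}\}\cup\{\mathcal{H}(G):G\in\mathcal{G}\}$; the upper Fell topology $\tau_{uF}$ on $\mathcal{F}$ is generated by $\{\mathcal{M}(K):K\in\mathcal{K}\}$. Their Borel $\sigma$-algebras coincide: $\mathcal{B}_F:=\sigma(\tau_F)=\sigma(\tau_{uF})$. Weak convergence: for a topological space $(X,\mathcal{O})$ and a net $(P_\alpha)_{\alpha\in A}$ ($A$ a directed set) of probability measures and a probability measure $P$ on $(X,\sigma(\mathcal{O}))$, $P_\alpha\rightarrow_w P$ on $(X,\mathcal{O})$ means convergence in the weak topology (the initial topology with respect to the maps $P\mapsto P(O)$, $O\in\mathcal{O}$, into $\mathbb{R}$ with the topology $\{(a,\infty):a\in\mathbb{R}\}\cup\{\emptyset,\mathbb{R}\}$); equivalently, $\liminf_\alpha P_\alpha(O)\ge P(O)$ for all $O\in\mathcal{O}$; equivalently, $\limsup_\alpha P_\alpha(F)\le P(F)$ for all closed sets $F$ of $(X,\mathcal{O})$. A random closed set in $E$ on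 a probability space $(\Omega,\mathcal{A},\mathbb{P})$ is an $\mathcal{A}$-$\mathcal{B}_F$ measurable map $C:\Omega\to\mathcal{F}$. $C_\alpha \stackrel{\mathcal{D}}{\rightarrow} C$ in $(\mathcal{F},\tau_{uF})$ means $\mathbb{P}_\alpha\circ C_\alpha^{-1}\rightarrow_w \mathbb{P}\circ C^{-1}$ on $(\mathcal{F},\tau_{uF})$. Likewise $\xi_\alpha \stackrel{\mathcal{D}}{\rightarrow} \xi$ in $(E,\mathcal{G})$ means $\mathbb{P}_\alpha\circ \xi_\alpha^{-1}\rightarrow_w \mathbb{P}\circ \xi^{-1}$ on $(E,\mathcal{G})$. ''$C\subseteq D$ $\mathbb{P}$-a.s.'' means that $\{\omega: C(\omega)\nsubseteq D(\omega)\}$ is a $\mathbb{P}$-null set (outer measure zero). The capacity functional of $C$ is $T_C(B)=\mathbb{P}(C\cap B\neq\emptyset)$; only its values on closed sets $B$ matter here. *)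

(* Defs.v *)
From HB Require Import structures.
From mathcomp Require Import all_boot all_order all_algebra finmap.
From mathcomp Require Import all_classical all_reals all_analysis.

Set Implicit Arguments.
Unset Strict Implicit.
Unset Printing Implicit Defensive.

Import Order.TTheory GRing.Theory Num.Theory.

Local Open Scope classical_set_scope.
Local Open Scope ring_scope.

Record directed_set (A : Type) (le : A -> A -> Prop) : Prop := DirectedSet {
  directed_nonempty : [set: A] !=set0 ;
  directed_refl : forall a, le a a ;
  directed_trans : forall a b c, le a b -> le b c -> le a c ;
  directed_ub : forall a b, exists c, le a c /\ le b c }.

Definition tails (A : Type) (le : A -> A -> Prop) : set_system A :=
  filter_from [set: A] (fun a => [set b | le a b]).

Lemma tails_filter (A : Type) (le : A -> A -> Prop) :
  directed_set le -> ProperFilter (tails le).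
Proof.
move=> [[a0 _] rle tle dle]; apply: filter_from_proper; last first.
  by move=> a _; exists a; exact: rle.
apply: filter_from_filter; first by exists a0.
move=> a b _ _; have [c [ac bc]] := dle a b.
by exists c => // x /= cx; split; [apply: tle ac _|apply: tle bc _].
Qed.

Section net_limits.
Context {R : realType} {A : Type}.
Implicit Types (le : A -> A -> Prop) (u : A -> \bar R).

Definition net_limsup le u : \bar R :=
  ereal_inf [set ereal_sup [set u b | b in [set b | le a b]] | a in [set: A]].

Definition net_liminf le u : \bar R :=
  ereal_sup [set ereal_inf [set u b | b in [set b | le a b]] | a in [set: A]].

End net_limits.

Notation borel X := (g_sigma_algebraType (@open X)).

Definition upper_real (R : realType) : Type := R.

Section upper_real.
Variable R : realType.

Definition upper_real_open : set_system (upper_real R) :=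
  [set U | U = set0 \/ U = setT \/ exists a : R, U = [set x : R | a < x]].

Let upper_openT : upper_real_open setT.
Proof. by right; left. Qed.

Let upper_openI : setI_closed upper_real_open.
Proof.
move=> U V [->|[->|[a ->]]]; first by rewrite set0I; left.
  by rewrite setTI.
move=> [->|[->|[b ->]]]; first by rewrite setI0; left.
  by rewrite setIT; right; right; exists a.
right; right; exists (Num.max a b); apply/seteqP; split => x /=.
  by rewrite gt_max => -[-> ->].
by rewrite gt_max => /andP[].
Qed.

Let upper_open_bigcup (I : Type) (g : I -> set (upper_real R)) :
  (forall i, upper_real_open (g i)) -> upper_real_open (\bigcup_i g i).
Proof.
move=> og.
pose S := [set a : R | [set x : R | a < x] `<=` \bigcup_i g i].
have gS (x : R) : (\bigcup_i g i) x -> exists2 a, S a & a < x.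
  move=> [i _]; have [gi|[gi|[a gi]]] := og i; rewrite gi// => ax.
    by exists (x - 1); [move=> y _; exists i; rewrite ?gi|rewrite gtrBl].
  by exists a => // y ay; exists i; rewrite ?gi.
have [[x Ux]|/set0P/negP/negPn/eqP->] := pselect (\bigcup_i g i !=set0); last first.
  by left.
have [a0 Sa0 _] := gS _ Ux.
have [lS|nlS] := pselect (has_lbound S).
  right; right; exists (inf S); apply/seteqP; split => y.
    by move=> /gS[a Sa]; apply: le_lt_trans; exact: ge_inf.
  by move=> /(inf_lt (ex_intro _ _ Sa0))[a Sa ay]; exact: Sa.
right; left; apply/seteqP; split => // y _.
have /existsNP[a /not_implyP[Sa /negP]] : ~ lbound S y by move=> ?; apply: nlS; exists y.
by rewrite -ltNge; exact: Sa.
Qed.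

HB.instance Definition _ := Choice.copy (upper_real R) R.
HB.instance Definition _ := isOpenTopological.Build (upper_real R)
  upper_openT upper_openI upper_open_bigcup.

End upper_real.

Section weak_topology.
Context (X : ptopologicalType) (R : realType).

Definition open_mass (O : {O : set X | open O}) (P : probability (borel X) R) :
  upper_real R := fine (P (sval O)).

(** Supremum of the initial topologies of the maps [P |-> P O], [O] open, i.e.
    the initial topology of the whole family. *)
Definition weak_probability : topologicalType :=
  sup_topology (fun O => Topological.class (initial_topology (open_mass O))).

End weak_topology.

Definition weak_cvg (X : ptopologicalType) (R : realType)
    (A : Type) (le : A -> A -> Prop)
    (Pa : A -> probability (borel X) R) (P : probability (borel X) R) : Prop :=
  (Pa : A -> weak_probability X R) @ tails le --> (P : weak_probability X R).

Definition cvg_in_distribution (X : ptopologicalType) (R : realType)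
    (A : Type) (le : A -> A -> Prop)
    (da : A -> measure_display) (Omegaa : forall a, measurableType (da a))
    (Pa : forall a, probability (Omegaa a) R)
    (d : measure_display) (Omega : measurableType d) (P : probability Omega R)
    (Ya : forall a, {RV (Pa a) >-> borel X}) (Y : {RV P >-> borel X}) : Prop :=
  weak_cvg le (fun a => distribution (Pa a) (Ya a)) (distribution P Y).

Record closed_set (E : topologicalType) := ClosedSet {
  cset :> set E ;
  closed_cset : closed cset }.

Section hyperspace.
Variable E : topologicalType.

HB.instance Definition _ := gen_eqMixin (closed_set E).
HB.instance Definition _ := gen_choiceMixin (closed_set E).
HB.instance Definition _ := isPointed.Build (closed_set E)
  (ClosedSet (@closed0 E)).

Definition miss (B : set E) : set (closed_set E) := [set F | F `&` B = set0].
Definition hit (B : set E) : set (closed_set E) := [set F | F `&` B !=set0].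

Definition upper_fell_subbase : set_system (closed_set E) :=
  [set miss K | K in compact].

Definition fell_subbase : set_system (closed_set E) :=
  [set miss K | K in compact] `|` [set hit G | G in open].

Definition upper_fell : Type := closed_set E.
Definition fell : Type := closed_set E.

HB.instance Definition _ := Pointed.copy upper_fell (closed_set E).
HB.instance Definition _ :=
  isSubBaseTopological.Build upper_fell upper_fell_subbase id.

HB.instance Definition _ := Pointed.copy fell (closed_set E).
HB.instance Definition _ :=
  isSubBaseTopological.Build fell fell_subbase id.

Lemma fell_subbase_open (U : set fell) : fell_subbase U -> open U.
Proof.
move=> sU; exists [set U]; last by rewrite bigcup_set1.
move=> _ ->; exists [fset U]%fset.
  by move=> V; rewrite in_fset1 => /eqP ->; exact: mem_set.
apply/seteqP; split=> F /=; first by apply; rewrite /= in_fset1.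
by move=> UF V /=; rewrite in_fset1 => /eqP ->.
Qed.

Lemma upper_fell_open_fell (U : set (closed_set E)) :
  open (U : set upper_fell) -> open (U : set fell).
Proof.
move=> [D sD <-]; apply: bigcup_open => B /sD[J sJ <-].
rewrite openE => F JF; apply: filter_bigI => V JV.
apply: open_nbhs_nbhs; split; last exact: JF.
by apply: fell_subbase_open; left; exact: set_mem (sJ _ JV).
Qed.

End hyperspace.

Section random_closed_set.
Context (E : topologicalType) (R : realType) (d : measure_display)
  (Omega : measurableType d) (P : probability Omega R).

(** The same map, seen as measurable for the Borel sets of the coarser upper
    Fell topology (both topologies have the same Borel sets when [E] is locally
    compact, second countable and Hausdorff). *)
Definition upper_fell_map (C : Omega -> borel (fell E)) :
  Omega -> borel (upper_fell E) := C.

Lemma measurable_upper_fell_map (C : {RV P >-> borel (fell E)}) :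
  measurable_fun [set: Omega] (upper_fell_map C).
Proof.
apply: (@measurability _ _ _ (borel (upper_fell E)) _ _ (@open (upper_fell E))).
  by [].
move=> _ [U oU <-]; apply: (measurable_funPT C) => //.
by apply: sub_sigma_algebra; exact: upper_fell_open_fell.
Qed.

HB.instance Definition _ (C : {RV P >-> borel (fell E)}) :=
  isMeasurableFun.Build _ _ _ _ (upper_fell_map C)
    (measurable_upper_fell_map C).

Definition to_upper_fell (C : {RV P >-> borel (fell E)}) :
  {RV P >-> borel (upper_fell E)} := upper_fell_map C.

(** Meaningful only where the event is measurable, e.g. for closed [B]. *)
Definition capacity (C : {RV P >-> borel (fell E)}) (B : set E) : \bar R :=
  P [set w | cset (C w) `&` B !=set0].

End random_closed_set.

(* Main.v *)
Require Import Defs.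
From HB Require Import structures.
From mathcomp Require Import all_boot all_order all_algebra.
From mathcomp Require Import all_classical all_reals all_analysis.
From mathcomp Require Import lra.

Set Implicit Arguments.
Unset Strict Implicit.
Unset Printing Implicit Defensive.

Import Order.TTheory GRing.Theory Num.Theory.

Local Open Scope classical_set_scope.
Local Open Scope ring_scope.

(** The argument rests on one inclusion of events. For [F] closed and [K]
    compact, [xi \in F] forces [xi \notin K], or [xi \notin C], or
    that [C] hits the compact set [F `&` K]; so
    [P (xi \in F) <= P (xi \notin K) + P (xi \notin C) + P (C hits F `&` K)]
    ([selection_measure_le]). Along the net the first term is eventually at most
    any prescribed number, by tightness and a suitable choice of [K], and the
    second tends to [0]. For the third, the closed sets missing [F `&` K] form an
    open set of the upper Fell topology, so weak convergence bounds its upper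
    limit by
    [P (C hits F `&` K)], hence by the capacity of [F].

    If moreover [C] is almost surely contained in [[set xi]], then [C] hits [F]
    only if [xi \in F], up to a null set. The first part thus gives
    [limsup P_a (xi_a \in F) <= P (xi \in F)] for [F] closed; taking
    complements, this is weak convergence, in the form of the lower bounds on
    open sets proved equivalent to it in [weak_cvgP].

    The events [xi \notin C] and [C hits F] have to be shown measurable.
    Local compactness and second countability provide a countable base of
    relatively compact open sets whose closures separate points from closed sets
    ([exists_separating_base]). It writes both events as countable unions of
    events determined by [xi \in U], with [U] open, and by [C] hitting or
    missing a compact set. *)

(** * Nets and weak convergence *)

Section net.
Context {R : realType} {A : Type} (le : A -> A -> Prop).
Implicit Types u : A -> \bar R.
Local Open Scope ereal_scope.

Lemma net_limsup_lt u c : net_limsup le u < c ->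
  \forall a \near tails le, u a < c.
Proof.
move=> /ereal_inf_lt[_ [a _ <-] supc]; exists a => // b ab.
by apply: le_lt_trans supc; apply: ereal_sup_ubound; exists b.
Qed.

Lemma lt_net_liminf u c : c < net_liminf le u ->
  \forall a \near tails le, c < u a.
Proof.
move=> /ereal_sup_gt[_ [a _ <-] cinf]; exists a => // b ab.
by apply: lt_le_trans cinf _; apply: ereal_inf_lbound; exists b.
Qed.

Lemma net_limsup_le u c : (\forall a \near tails le, u a <= c) ->
  net_limsup le u <= c.
Proof.
move=> [a _ uc]; apply: ge_ereal_inf; eexists; first by exists a.
by apply: ge_ereal_sup => _ [b ab <-]; exact: uc.
Qed.

End net.

(** Convergence in the weak topology is the lower semicontinuity condition
    [P O <= liminf (P_a O)] for all open [O]: a subbasic neighbourhood of [P]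
    is given by an open set [O] and a half-line [t < P O]. *)
Lemma weak_cvgP (X : ptopologicalType) (R : realType) (A : Type)
    (le : A -> A -> Prop) (Pa : A -> probability (borel X) R)
    (P : probability (borel X) R) : directed_set le ->
  weak_cvg le Pa P <->
  forall O : set X, open O -> forall t : R, (t%:E < P O)%E ->
    \forall a \near tails le, (t%:E < Pa a O)%E.
Proof.
move=> dirA; have ? := tails_filter dirA.
have massE (Q : probability (borel X) R) (O : set X) (t : R) : open O ->
    (t < fine (Q O)) = (t%:E < Q O)%E.
  move=> oO; rewrite -lte_fin fineK//; apply: fin_num_measure.
  exact: sub_sigma_algebra.
split.
  move=> /cvg_sup cvgPa O oO t tPO.
  pose i : {O : set X | open O} := exist _ O oO.
  have := cvgPa i [set Q : probability (borel X) R | (t%:E < Q O)%E].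
  apply.
  exists [set Q : probability (borel X) R | (t%:E < Q O)%E]; split => //.
  exists [set x : R | t < x]; first by right; right; exists t.
  by apply/seteqP; split => Q; rewrite /= /open_mass/= massE.
move=> H; apply/cvg_sup => -[G oG] W /= [_ [[V oV <-] /= VP VW]].
apply: (@filterS _ (tails le) _ [set a | V (open_mass (exist _ G oG) (Pa a))]).
  by move=> a Va; exact: VW.
(* an open set of [upper_real R] is empty, full, or an open upper half-line *)
move: oV VP => [-> []|[->|[t ->]]]; first by move=> _; exact: filterT.
rewrite /open_mass /= massE // => /(H _ oG); apply: filterS => a /=.
by rewrite massE.
Qed.

(** * Locally compact second-countable spaces *)

Section topology.
Context (E : ptopologicalType).

(** A family of relatively compact open sets such that every point outside a
    closed set [C] has a neighbourhood in the family with closure disjoint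
    from [C]. *)
Definition separating_base (B : set (set E)) :=
  (forall U, B U -> open U /\ compact (closure U)) /\
  (forall C x, closed C -> ~ C x ->
    exists U, [/\ B U, U x & C `&` closure U = set0]).

Lemma exists_separating_base :
  hausdorff_space E -> locally_compact [set: E] -> @second_countable E ->
  exists2 B, countable B & separating_base B.
Proof.
move=> hE lcE [B cB [Bo Bn]].
exists (B `&` [set U | compact (closure U)]).
  by apply: sub_countable cB; apply: subset_card_le => U [].
split=> [U [BU cU]|C x cC Cx]; first by split=> //; exact: Bo.
have [K nK [cK _]] := lcE x I; rewrite withinET in nK.
have : nbhs x (~` C) by apply: open_nbhs_nbhs; split=> //; exact: closed_openC.
move=> /(compact_regular hE cK nK)[V nV VC].
have [U [BU Ux] UVK] := Bn x (V `&` K) (filterI nV nK).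
exists U; split=> //.
  split=> //; apply: (subclosed_compact _ cK); first exact: closed_closure.
  rewrite [X in _ `<=` X](closure_id K).1; last exact: compact_closed.
  by apply: closureS => y /UVK[].
apply/seteqP; split=> // y [Cy Uy]; apply: (VC y) => //.
by move: y Uy {Cy}; apply: closureS => y /UVK[].
Qed.

End topology.

(** * Measurability of hitting events *)

Lemma countable_bigcup_measurable (d : measure_display)
    (T : sigmaRingType d) (U : Type) (D : set U) (F : U -> set T) :
  countable D -> (forall i, D i -> measurable (F i)) ->
  measurable (\bigcup_(i in D) F i).
Proof.
move=> /pfcard_geP[->|[f]] mF; first by rewrite bigcup_set0.
have <- : f @` setT = D.
  exact: surj_image_eq.
rewrite bigcup_image; apply: bigcupT_measurable => n; apply: mF.
exact: funS.
Qed.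

Lemma upper_fell_miss_open (E : topologicalType) (K : set E) : compact K ->
  open (miss K : set (upper_fell E)).
Proof.
move=> cK; exists [set miss K]; last by rewrite bigcup_set1.
by move=> _ ->; apply: (@finI_from1 _ _ _ id); exists K.
Qed.

Section random_sets.
Context (E : ptopologicalType) (R : realType) (d : measure_display)
  (Omega : measurableType d) (P : probability Omega R).
Context (hausE : hausdorff_space E) (lcE : locally_compact [set: E])
  (scE : @second_countable E).
Context (C : {RV P >-> borel (fell E)}) (xi : {RV P >-> borel E}).

Lemma measurable_RV_open (U : set E) : open U ->
  measurable [set w | U (xi w)].
Proof.
move=> oU; apply: (measurable_funPTI xi (Y := U)); exact: sub_sigma_algebra.
Qed.

Lemma measurable_RV_closed (F : set E) : closed F ->
  measurable [set w | F (xi w)].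
Proof.
move=> cF; rewrite (_ : [set w | _] = ~` [set w | (~` F) (xi w)]).
  by apply: measurableC; apply: measurable_RV_open; exact: closed_openC.
by apply/seteqP; split=> w /=; [move=> Fw; apply | exact: contrapT].
Qed.

Lemma measurable_miss_compact (K : set E) : compact K ->
  measurable [set w | cset (C w) `&` K = set0].
Proof.
move=> cK; apply: (measurable_funPTI C (Y := miss K)).
apply: sub_sigma_algebra; apply: upper_fell_open_fell.
exact: upper_fell_miss_open.
Qed.

Lemma hit_missC (K : set E) : [set w | cset (C w) `&` K !=set0] =
  ~` [set w | cset (C w) `&` K = set0].
Proof. by apply/seteqP; split=> w /=; [move=> /set0P/eqP | move=> /eqP/set0P]. Qed.

Lemma measurable_hit_compact (K : set E) : compact K ->
  measurable [set w | cset (C w) `&` K !=set0].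
Proof.
by move=> cK; rewrite hit_missC; apply: measurableC; exact: measurable_miss_compact.
Qed.

(** A closed set [F] is the countable union of the compact sets
    [F `&` closure U], for [U] in a separating base. *)
Lemma measurable_hit_closed (F : set E) : closed F ->
  measurable [set w | cset (C w) `&` F !=set0].
Proof.
move=> cF; have [B cB [Bo Bsep]] := exists_separating_base hausE lcE scE.
rewrite (_ : [set w | _] = \bigcup_(U in B)
    [set w | cset (C w) `&` (F `&` closure U) !=set0]).
  apply: countable_bigcup_measurable => // U BU.
  apply: measurable_hit_compact; apply: subclosed_compact (Bo _ BU).2 _.
    by apply: closedI => //; exact: closed_closure.
  exact: subIsetr.
apply/seteqP; split=> [w [x [Cx Fx]]|w [U _ [x [Cx [Fx _]]]]]; last by exists x.
(* separating [x] from the empty set shows that the family covers [E] *)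
have [U [BU Ux _]] := Bsep set0 x (@closed0 E) id.
by exists U => //; exists x; split=> //; split=> //; exact: subset_closure.
Qed.

(** A point is outside [C w] exactly when some member of a separating base
    contains it and has a closure missed by [C w]. *)
Lemma measurable_notin : measurable [set w | ~ cset (C w) (xi w)].
Proof.
have [B cB [Bo Bsep]] := exists_separating_base hausE lcE scE.
rewrite (_ : [set w | _] = \bigcup_(U in B)
    ([set w | U (xi w)] `&` [set w | cset (C w) `&` closure U = set0])).
  apply: countable_bigcup_measurable => // U /Bo[oU cU].
  apply: measurableI; first exact: measurable_RV_open.
  exact: measurable_miss_compact.
apply/seteqP; split=> [w /= Cw|w [U _ [/= Ux CU0]] Cx].
  have [U [BU Ux CU]] := Bsep _ _ (@closed_cset _ (C w)) Cw.
  by exists U.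
have : (cset (C w) `&` closure U) (xi w) by split=> //; exact: subset_closure.
by rewrite CU0.
Qed.

Lemma selection_measure_le (F K : set E) : closed F -> compact K ->
  (P [set w | F (xi w)] <= P [set w | ~ K (xi w)] +
     (P [set w | ~ cset (C w) (xi w)] +
      P [set w | cset (C w) `&` (F `&` K) !=set0]))%E.
Proof.
move=> cF cK; have clK := compact_closed hausE cK.
have mK : measurable [set w | ~ K (xi w)].
  by apply: (@measurable_RV_open (~` K)); exact: closed_openC.
have mh : measurable [set w | cset (C w) `&` (F `&` K) !=set0].
  apply: measurable_hit_compact; apply: subclosed_compact cK _ => //.
  exact: closedI.
have mC := measurable_notin.
apply: (@le_trans _ _ (P ([set w | ~ K (xi w)] `|`
   ([set w | ~ cset (C w) (xi w)] `|`
      [set w | cset (C w) `&` (F `&` K) !=set0])))).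
  apply: le_measure; rewrite ?inE.
  - exact: measurable_RV_closed.
  - by apply: measurableU => //; exact: measurableU.
  - move=> w /= Fw; have [Kw|] := pselect (K (xi w)); last by left.
    have [Cw|] := pselect (cset (C w) (xi w)); last by right; left.
    by right; right; exists (xi w).
apply: le_trans (measureU2 _ _ _) _ => //; first exact: measurableU.
by rewrite leeD2l// measureU2.
Qed.

End random_sets.

(** * Limits of random selections *)

Theorem theorem6 (R : realType) (E : ptopologicalType)
    (hausE : hausdorff_space E) (lcE : locally_compact [set: E])
    (scE : @second_countable E)
    (A : Type) (le : A -> A -> Prop) (dirA : directed_set le)
    (da : A -> measure_display) (Omegaa : forall a, measurableType (da a))
    (Pa : forall a, probability (Omegaa a) R)
    (d : measure_display) (Omega : measurableType d) (P : probability Omega R)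
    (Ca : forall a, {RV (Pa a) >-> borel (fell E)})
    (C : {RV P >-> borel (fell E)})
    (xia : forall a, {RV (Pa a) >-> borel E})
    (cvgC : cvg_in_distribution le
              (fun a => to_upper_fell (Ca a)) (to_upper_fell C))
    (selC : net_limsup le
              (fun a => Pa a [set w | ~ cset (Ca a w) (xia a w)]) = 0%E)
    (tight : forall eps : R, 0 < eps -> exists2 K : set E, compact K &
       ((1 - eps)%:E <= net_liminf le (fun a => Pa a [set w | K (xia a w)]))%E) :
  (forall F : set E, closed F ->
     (net_limsup le (fun a => Pa a [set w | F (xia a w)]) <= capacity C F)%E)
  /\
  (forall xi : {RV P >-> borel E},
     {ae P, forall w, cset (C w) `<=` [set (xi w : E)]} ->
     cvg_in_distribution le xia xi).
Proof.
have ft := tails_filter dirA.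
have fin d' (T : measurableType d') (Q : probability T R) (S : set T) :
    measurable S -> Q S = (fine (Q S))%:E.
  by move=> mS; rewrite fineK// fin_num_measure.
have limsup_cap (F : set E) : closed F ->
    (net_limsup le (fun a => Pa a [set w | F (xia a w)]) <= capacity C F)%E.
  move=> cF; apply/lee_addgt0Pr => e e0.
  have e4 : 0 < e / 4 by rewrite divr_gt0.
  have [K cK tK] := tight _ e4.
  have clK := compact_closed hausE cK.
  have cFK : compact (F `&` K).
    apply: subclosed_compact cK _; first exact: closedI.
    exact: subIsetr.
  have mmiss := measurable_miss_compact C cFK.
  have mhit := measurable_hit_compact C cFK.
  have mhitF := measurable_hit_closed hausE lcE scE C cF.
  apply: net_limsup_le.
  (* the strict slack from [e / 4] to [e / 2] turns the bound on the lower
     limit into a bound that eventually holds *)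
  have nK : \forall a \near tails le,
      ((1 - e / 2)%:E < Pa a [set w | K (xia a w)])%E.
    apply: lt_net_liminf; apply: lt_le_trans tK; rewrite lte_fin; lra.
  have nC : \forall a \near tails le,
      (Pa a [set w | ~ cset (Ca a w) (xia a w)] < (e / 4)%:E)%E.
    by apply: net_limsup_lt; rewrite selC lte_fin.
  have nM : \forall a \near tails le,
      ((fine (P [set w | cset (C w) `&` (F `&` K) = set0]) - e / 4)%:E <
       Pa a [set w | cset (Ca a w) `&` (F `&` K) = set0])%E.
    have /weak_cvgP := cvgC; move/(_ dirA _ (upper_fell_miss_open cFK)); apply.
    rewrite EFinB fineK ?fin_num_measure//.
    by rewrite lteBlDr// lteDl ?fin_num_measure// lte_fin.
  apply: filterS3 nK nC nM => a.
  have mKa := measurable_RV_closed (xia a) clK.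
  have mna := measurable_notin hausE lcE scE (Ca a) (xia a).
  have mma := measurable_miss_compact (Ca a) cFK.
  have mFa := measurable_RV_closed (xia a) cF.
  have hF : (P [set w | cset (C w) `&` (F `&` K) !=set0] <= capacity C F)%E.
    apply: le_measure; rewrite ?inE//.
    by move=> w [x [Cx [Fx _]]]; exists x.
  have := selection_measure_le hausE lcE scE (Ca a) (xia a) cF cK.
  rewrite (_ : [set w | ~ K (xia a w)] = ~` [set w | K (xia a w)])//.
  rewrite (hit_missC (Ca a)) (probability_setC _ mKa) (probability_setC _ mma).
  move: hF; rewrite (hit_missC C) (probability_setC _ mmiss).
  rewrite /capacity (fin _ _ _ _ mFa) (fin _ _ _ _ mKa) (fin _ _ _ _ mna).
  rewrite (fin _ _ _ _ mma) (fin _ _ _ _ mmiss) (fin _ _ _ _ mhitF) /=.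
  rewrite -?EFinB -?EFinD !lee_fin !lte_fin; lra.
split=> // xi Cxi; apply/weak_cvgP => // G oG t tG.
have cG := open_closedC oG.
have mG := measurable_RV_open xi oG.
have mCG := measurable_RV_closed xi cG.
have hitle : (capacity C (~` G) <= P [set w | (~` G) (xi w)])%E.
  have [N [mN PN0 CN]] := Cxi.
  apply: (@le_trans _ _ (P ([set w | (~` G) (xi w)] `|` N))).
    apply: le_measure; rewrite ?inE.
    - exact: measurable_hit_closed.
    - exact: measurableU.
    - move=> w [x [Cx Gx]]; have [Cw|Cw] := pselect (cset (C w) `<=` [set xi w]).
        by left; rewrite /= -(Cw _ Cx).
      by right; apply: CN.
  by apply: le_trans (measureU2 _ _ _) _; rewrite // [X in (_ + X)%E]PN0 adde0.
have lim1 : (net_limsup le (fun a => Pa a [set w | (~` G) (xia a w)]) <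
             (1 - t)%:E)%E.
  apply: le_lt_trans (limsup_cap _ cG) _; apply: le_lt_trans hitle _.
  have : (t%:E < P [set w | G (xi w)])%E by exact: tG.
  rewrite (probability_setC _ mG) (fin _ _ _ _ mG) -EFinB !lte_fin; lra.
have := net_limsup_lt lim1; apply: filterS => a /=.
have mGa := measurable_RV_open (xia a) oG.
rewrite (probability_setC _ mGa) => GC.
suff : (t%:E < Pa a [set w | G (xia a w)])%E by [].
move: GC; rewrite (fin _ _ _ _ mGa) -EFinB !lte_fin; lra.
Qed.
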